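(* Let $(\bar Y,\bar u,\bar v,\bar z,\bar l)\in\Lambda$. Then the outer approximation (OA) cut at this point associated with the constraints $$\epsilon_H\|Y_{jt}\|_2+Y_{jt}^{\mathsf T}\hat{\mathbf d}^h-S_{jt}\le M_h(1-w_h),\qquad j\in[J],\ t\in[T],\ h\in[H],$$ is $$\epsilon_H\bar Y_{jt}^{\mathsf T}Y_{jt}+\big(Y_{jt}^{\mathsf T}\hat{\mathbf d}^h-S_{jt}-M_h+M_hw_h\big)\,\|\bar Y_{jt}\|_2\le0,\qquad\forall j\in[J],\ t\in[T],\ h\in[H].$$ That is, for each $j,t,h$ this linear inequality in $(Y_{jt},S_{jt},w_h)$ is satisfied by every $(Y_{jt},S_{jt},w_h)$ that satisfies the corresponding constraint, and, when $\bar Y_{jt}\neq0$, it is equivalent to the first-order linearization inequality of that constraint at a point with $Y_{jt}=\bar Y_{jt}$.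
   Context: Notation: $I,J,T,H$ are positive integers, $[n]=\{1,\dots,n\}$; $\epsilon_H\ge0$ is a real number; $\hat{\mathbf d}^1,\dots,\hat{\mathbf d}^H\in\mathbb R^I$ are given samples; $M_h$ are given real (big-M) constants; $c_{ji}$, $\mu(1),\dots,\mu(T),\mu(\infty)$ are given real numbers and $\alpha\in[0,1]$. Write $Y_{jt}=(Y_{j1t},\dots,Y_{jIt})^{\mathsf T}\in\mathbb R^I$. The set $\Lambda$ consists of all $(Y,u,v,z,l)$ with $Y=(Y_{jit})$, $Y_{jit}\in[0,1]$ for $j\in[J],i\in[I],t\in[T]$, $u,v,z\in\mathbb R^I$, $l\in\mathbb R^H$, satisfying for all $i\in[I]$: $\alpha\le\sum_{t\in[T]}\sum_{j\in[J]}Y_{jit}\le1$, $u_i=\sum_{t\in[T]}\sum_{j\in[J]}c_{ji}Y_{jit}$, $v_i=\sum_{t\in[T]}\sum_{j\in[J]}\mu(t)Y_{jit}$, $z_i=\mu(\infty)\big(1-\sum_{t\in[T]}\sum_{j\in[J]}Y_{jit}\big)$. (Points of $\Lambda$ need not satisfy the constraints being approximated.) OA cut: for a convex constraint $\psi(x)\le0$ and a point $\bar x$ at which $\psi$ is differentiable, the OA cut at $\bar x$ is the linear inequality $\psi(\bar x)+\nabla\psi(\bar x)^{\mathsf T}(x-\bar x)\le0$ (up to multiplication by a positive constant). Here the constraint is $\psi_{jth}\le0$ with $\psi_{jth}=\epsilon_H\|Y_{jt}\|_2+Y_{jt}^{\mathsf T}\hat{\mathbf d}^h-S_{jt}-M_h(1-w_h)$,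 regarded as a function of the continuous-relaxed variables $(Y_{jt},S_{jt},w_h)$; since it is affine in $(S_{jt},w_h)$, the linearization does not depend on the values of $S_{jt},w_h$ at the linearization point. If $\bar Y_{jt}=0$ the cut is vacuous. *)

(* Defs.v *)
From HB Require Import structures.
From mathcomp Require Import all_boot all_order all_algebra.
From mathcomp Require Import all_classical all_reals all_analysis.
Set Implicit Arguments.
Unset Strict Implicit.
Unset Printing Implicit Defensive.
Import Order.TTheory GRing.Theory Num.Theory.
Import numFieldNormedType.Exports.
Local Open Scope classical_set_scope.
Local Open Scope ring_scope.

Definition dotp (R : realType) (n : nat) (x y : 'rV[R]_n) : R :=
  \sum_(i < n) x 0 i * y 0 i.

(* [`|x|] on ['rV[R]_n] is the sup norm, hence a separate Euclidean norm. *)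
Definition norm2 (R : realType) (n : nat) (x : 'rV[R]_n) : R :=
  Num.sqrt (dotp x x).

(* [ptY p j t] is the vector Y_jt in R^I, whose entry [ptY p j t 0 i] is
   Y_jit. *)
Record lambda_point (R : realType) (I J T H : nat) := LambdaPoint {
  ptY : 'I_J -> 'I_T -> 'rV[R]_I;
  ptu : 'rV[R]_I;
  ptv : 'rV[R]_I;
  ptz : 'rV[R]_I;
  ptl : 'rV[R]_H
}.

(* The ordinal t : 'I_T stands for the index t + 1 of {1, ..., T}, so that
   [mu t] is mu(t + 1); mu(infty) is the separate parameter [muinf].  The
   component l is unconstrained in Lambda. *)
Definition Lambda (R : realType) (I J T H : nat) (alpha : R)
    (c : 'I_J -> 'I_I -> R) (mu : 'I_T -> R) (muinf : R) :
    set (lambda_point R I J T H) :=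
  [set p |
    (forall j i t, 0 <= ptY p j t 0 i <= 1) /\
    forall i : 'I_I,
      [/\ alpha <= \sum_(t < T) \sum_(j < J) ptY p j t 0 i <= 1,
          ptu p 0 i = \sum_(t < T) \sum_(j < J) c j i * ptY p j t 0 i,
          ptv p 0 i = \sum_(t < T) \sum_(j < J) mu t * ptY p j t 0 i &
          ptz p 0 i =
            muinf * (1 - \sum_(t < T) \sum_(j < J) ptY p j t 0 i)]].

(* First-order expansion of psi at xb, evaluated at x.  The differential of a
   real-valued function on a finite-dimensional space, applied to x - xb, is
   the inner product of the gradient with x - xb. *)
Definition linearization (R : realType) (V : normedModType R) (psi : V -> R)
    (xb x : V) : R :=
  psi xb + 'd psi xb (x - xb).

(* The inequality [a x <= 0] is the outer approximation cut at xb of the convex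
   constraint [psi x <= 0], up to multiplication by a positive constant. *)
Definition is_OA_cut (R : realType) (V : normedModType R) (psi : V -> R)
    (xb : V) (a : V -> R) : Prop :=
  [/\ convex_function [set: convex_lmodType V] psi,
      differentiable psi xb &
      exists2 k : R, 0 < k & forall x : V, a x = k * linearization psi xb x].

(* The variables are (Y_jt, S_jt, w_h), with w_h relaxed to a real. *)
Definition vars (R : realType) (I : nat) : normedModType R :=
  ('rV[R]_I * R * R)%type.

Definition psi (R : realType) (I : nat) (eps : R) (d : 'rV[R]_I) (M : R)
    (x : vars R I) : R :=
  let Y := x.1.1 in let S := x.1.2 in let w := x.2 in
  eps * norm2 Y + dotp Y d - S - M * (1 - w).

Definition cut_lhs (R : realType) (I : nat) (eps : R) (d : 'rV[R]_I) (M : R)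
    (Yb : 'rV[R]_I) (x : vars R I) : R :=
  let Y := x.1.1 in let S := x.1.2 in let w := x.2 in
  eps * dotp Yb Y + (dotp Y d - S - M + M * w) * norm2 Yb.

(* Main.v *)
Require Import Defs.
From HB Require Import structures.
From mathcomp Require Import all_boot all_order all_algebra.
From mathcomp Require Import all_classical all_reals all_analysis.
From mathcomp Require Import ring lra.
Set Implicit Arguments.
Unset Strict Implicit.
Unset Printing Implicit Defensive.
Import Order.TTheory GRing.Theory Num.Theory.
Import numFieldNormedType.Exports.
Local Open Scope classical_set_scope.
Local Open Scope ring_scope.

(** Multiplying the first-order expansion of the constraint at a nonzero point
    [Yb] by [norm2 Yb > 0] gives the cut. The only nonlinear term of [psi] is
    [eps * norm2 Y], and the differential of the Euclidean norm at [Yb] is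
    [v |-> dotp Yb v / norm2 Yb] ([is_diff_norm2]); by homogeneity,
    [norm2 Yb + dotp Yb (Y - Yb) / norm2 Yb = dotp Yb Y / norm2 Yb], so the
    expansion does not retain any constant coming from the norm, and clearing
    the denominator yields [cut_lhs] exactly ([linearization_psi]). Convexity
    of [psi] is the triangle inequality for the Euclidean norm ([norm2D]),
    weighted by [eps >= 0].

    Validity of the cut holds even at [Yb = 0], where [psi] need not be
    differentiable: the Cauchy-Schwarz inequality [dotp_le_norm2] gives
    [cut_lhs <= norm2 Yb * psi] everywhere ([cut_lhs_le]), and the right-hand
    side is nonpositive wherever the constraint holds. At [Yb = 0] the cut
    reads [0 <= 0]. *)

(** * Inner product and Euclidean norm *)

Section dotp.
Context (R : realType) (n : nat).
Implicit Types x y z : 'rV[R]_n.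

Lemma dotpC x y : dotp x y = dotp y x.
Proof. by apply: eq_bigr => i _; rewrite mulrC. Qed.

Lemma dotpDl x y z : dotp (x + y) z = dotp x z + dotp y z.
Proof. by rewrite -big_split; apply: eq_bigr => i _; rewrite mxE mulrDl. Qed.

Lemma dotpZl a x y : dotp (a *: x) y = a * dotp x y.
Proof. by rewrite mulr_sumr; apply: eq_bigr => i _; rewrite mxE mulrA. Qed.

Lemma dotpDr x y z : dotp x (y + z) = dotp x y + dotp x z.
Proof. by rewrite dotpC dotpDl !(dotpC x). Qed.

Lemma dotpZr a x y : dotp x (a *: y) = a * dotp x y.
Proof. by rewrite dotpC dotpZl dotpC. Qed.

Lemma dot0p x : dotp 0 x = 0.
Proof. by rewrite -(scale0r 0) dotpZl mul0r. Qed.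

Lemma dotpBr x y z : dotp x (y - z) = dotp x y - dotp x z.
Proof. by rewrite -scaleN1r dotpDr dotpZr mulN1r. Qed.

Lemma dotpp_ge0 x : 0 <= dotp x x.
Proof. by apply: sumr_ge0 => i _; rewrite -expr2 sqr_ge0. Qed.

Lemma dotpp_eq0 x : (dotp x x == 0) = (x == 0).
Proof.
apply/eqP/eqP => [x0|->]; last exact: dot0p.
apply/rowP => i; rewrite mxE; apply/eqP; rewrite -sqrf_eq0 expr2; apply/eqP.
by apply: (psumr_eq0P _ x0) => // k _; rewrite -expr2 sqr_ge0.
Qed.

Lemma norm2_ge0 x : 0 <= norm2 x.
Proof. exact: sqrtr_ge0. Qed.

Lemma norm2_sqr x : norm2 x ^+ 2 = dotp x x.
Proof. by rewrite sqr_sqrtr ?dotpp_ge0. Qed.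

Lemma norm2_eq0 x : (norm2 x == 0) = (x == 0).
Proof. by rewrite -sqrf_eq0 norm2_sqr dotpp_eq0. Qed.

Lemma norm20 : norm2 (0 : 'rV[R]_n) = 0.
Proof. by apply/eqP; rewrite norm2_eq0. Qed.

Lemma norm2_gt0 x : (0 < norm2 x) = (x != 0).
Proof. by rewrite lt0r norm2_ge0 andbT norm2_eq0. Qed.

Lemma norm2Z a x : 0 <= a -> norm2 (a *: x) = a * norm2 x.
Proof.
move=> a0; rewrite /norm2 dotpZl dotpZr mulrA -expr2.
by rewrite sqrtrM ?sqr_ge0// sqrtr_sqr ger0_norm.
Qed.

(** Cauchy-Schwarz, from the nonnegativity of the squared norm of
    [norm2 y *: x - norm2 x *: y]; that squared norm equals twice
    [norm2 x * norm2 y * (norm2 x * norm2 y - dotp x y)], from which the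
    positive factor is cancelled. *)
Lemma dotp_le_norm2 x y : dotp x y <= norm2 x * norm2 y.
Proof.
have [->|x0] := eqVneq x 0; first by rewrite dot0p norm20 mul0r.
have [->|y0] := eqVneq y 0; first by rewrite dotpC dot0p norm20 mulr0.
have xy_gt0 : 0 < norm2 x * norm2 y by rewrite mulr_gt0 ?norm2_gt0.
have := dotpp_ge0 (norm2 y *: x - norm2 x *: y).
rewrite -scaleNr dotpDl !dotpDr !dotpZl !dotpZr (dotpC y x) -!norm2_sqr.
move=> xy; rewrite -(ler_pM2l xy_gt0); move: xy.
set a := norm2 x; set b := norm2 y; set s := dotp x y => xy; lra.
Qed.

Lemma norm2D x y : norm2 (x + y) <= norm2 x + norm2 y.
Proof.
rewrite -(@ler_pXn2r _ 2)// ?nnegrE ?addr_ge0 ?norm2_ge0//.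
rewrite norm2_sqr dotpDl !dotpDr (dotpC y x) -!norm2_sqr.
have := dotp_le_norm2 x y; lra.
Qed.

End dotp.

(** * Differential of the Euclidean norm *)

Section differential.
Context (R : realType).

Lemma is_diff_linear (V W : normedModType R) (f : V -> W) (x : V) :
  linear f -> continuous f -> is_diff x f f.
Proof.
move=> f_lin f_cont.
pose fM := GRing.isLinear.Build _ _ _ _ _ f_lin.
pose fL : {linear _ -> _} := HB.pack f fM.
apply: DiffDef; first exact: (@linear_differentiable _ _ _ fL).
exact: (@diff_lin _ _ _ fL).
Qed.

Lemma is_diff_sum (V W : normedModType R) (n : nat) (f df : 'I_n -> V -> W)
    (x : V) :
  (forall i, is_diff x (f i) (df i)) ->
  is_diff x (fun v => \sum_(i < n) f i v) (fun v => \sum_(i < n) df i v).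
Proof.
move=> f_df.
have -> : (fun v => \sum_(i < n) f i v) = \sum_(i < n) f i.
  by apply/funext => v; rewrite fct_sumE.
have -> : (fun v => \sum_(i < n) df i v) = \sum_(i < n) df i.
  by apply/funext => v; rewrite fct_sumE.
by elim/big_ind2 : _ => // *; [exact: is_diff_cst|exact: is_diffD].
Qed.

Context (n : nat).
Implicit Types x y : 'rV[R]_n.

Lemma is_diff_coord x (i : 'I_n) :
  is_diff x (fun v : 'rV[R]_n => v 0 i : R) (fun v => v 0 i).
Proof.
apply: is_diff_linear; last exact: coord_continuous.
by move=> a u v; rewrite !mxE.
Qed.

Lemma is_diff_dotpl x y : is_diff x (fun v => dotp v y) (fun v => dotp v y).
Proof.
apply: is_diff_sum => i.
have dx := is_diff_coord x i.
apply: (@is_diff_eq _ _ _ ((fun v : 'rV[R]_n => v 0 i) * cst (y 0 i))).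
by apply/funext => v /=; rewrite !fctE /= scaler0 add0r /= mulrC.
Qed.

Lemma is_diff_dotpp x : is_diff x (fun v => dotp v v) (fun v => 2 * dotp x v).
Proof.
have dsum : is_diff x (fun v => dotp v v)
    (fun v => \sum_(i < n) (x 0 i * v 0 i) *+ 2).
  apply: is_diff_sum => i.
  have dx := is_diff_coord x i.
  apply: (@is_diff_eq _ _ _ ((fun v : 'rV[R]_n => v 0 i) * (fun v => v 0 i))).
  by apply/funext => v; rewrite !fctE mulr2n.
apply: (is_diff_eq dsum).
by apply/funext => v; rewrite sumrMnl mulr_natl.
Qed.

(** Chain rule through the square root, whose derivative exists because
    [dotp x x > 0] for a nonzero [x]; the factor 2 of the square cancels the
    one of the root. *)
Lemma is_diff_norm2 x : x != 0 ->
  is_diff x (@norm2 R n) (fun v => dotp x v / norm2 x).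
Proof.
move=> x0; have dx := is_diff_dotpp x.
have xx_gt0 : 0 < dotp x x by rewrite -norm2_sqr exprn_gt0 ?norm2_gt0.
have sqrt_der := is_derive1_sqrt xx_gt0.
have sqrt_diff : is_diff (dotp x x) Num.sqrt
    (fun k => k *: (2 * norm2 x)^-1 : R).
  have [sqrt_derivable sqrt_val] := sqrt_der.
  apply: DiffDef; first exact/derivable1_diffP.
  by rewrite deriv1E// derive1E sqrt_val.
apply: (is_diff_eq (is_diff_comp dx sqrt_diff)).
apply/funext => v /=.
rewrite /GRing.scale /= invfM; have := norm2_gt0 x; rewrite x0 => nx.
field.
by rewrite gt_eqF.
Qed.

End differential.

(** * The constraint function and its cut *)

Section constraint.
Context (R : realType) (I : nat) (eps M : R) (d : 'rV[R]_I).

Lemma convex_psi : 0 <= eps ->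
  convex_function [set: convex_lmodType (vars R I)] (psi eps d M).
Proof.
move=> eps0 t [[Y S] w] [[Y' S'] w'] _ _.
have t0 : 0 <= t%:num by [].
have t1 : 0 <= (1 - t%:num) by rewrite subr_ge0.
have := norm2D (t%:num *: Y) ((1 - t%:num) *: Y').
rewrite !norm2Z// => /(ler_wpM2l eps0).
rewrite convRE /psi /= dotpDl !dotpZl /GRing.scale /= /unstable.onem.
lra.
Qed.

Lemma is_diff_psi (Y : 'rV[R]_I) (S w : R) : Y != 0 ->
  is_diff ((Y, S, w) : vars R I) (psi eps d M)
    (fun v => eps * (dotp Y v.1.1 / norm2 Y) + dotp v.1.1 d - v.1.2 + M * v.2).
Proof.
move=> Y0.
have dY : is_diff ((Y, S, w) : vars R I) (fun v => v.1.1) (fun v => v.1.1).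
  apply: is_diff_linear => // v; apply: (@continuous_comp _ _ _ fst fst);
  exact: cvg_fst.
have dS : is_diff ((Y, S, w) : vars R I) (fun v => v.1.2) (fun v => v.1.2).
  apply: is_diff_linear => // v; apply: (@continuous_comp _ _ _ fst snd);
  [exact: cvg_fst | exact: cvg_snd].
have dw : is_diff ((Y, S, w) : vars R I) snd snd.
  apply: is_diff_linear => // v; exact: cvg_snd.
have dN := is_diff_comp dY (is_diff_norm2 Y0).
have dD := is_diff_comp dY (is_diff_dotpl Y d).
have dA := is_diffD (is_diffB (is_diffD (is_diffZ eps dN) dD) dS)
  (is_diffD (is_diffZ M dw) (is_diff_cst (- M) _)).
(* The affine term [- M * (1 - w)] is split into [M * w] and the constant
   [- M], whose differential vanishes. *)
rewrite [X in is_diff _ X _](_ : _ =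
  eps *: (@norm2 R I \o (fun v : vars R I => v.1.1)) +
  ((fun v => dotp v d) \o (fun v : vars R I => v.1.1)) - (fun v => v.1.2) +
  (M *: snd + cst (- M))); last first.
  apply/funext => v; rewrite !fctE /psi /= /GRing.scale /=; ring.
apply: (is_diff_eq dA).
by apply/funext => v; rewrite !fctE /= /GRing.scale /= addr0.
Qed.

(** The constant part [eps * norm2 Y] of the expansion cancels against the
    term [- eps * dotp Y Y / norm2 Y] of the differential, and likewise the
    values of [S] and [w] at the expansion point cancel, since [psi] is affine
    in them. *)
Lemma linearization_psi (Y : 'rV[R]_I) (S w : R) (x : vars R I) : Y != 0 ->
  cut_lhs eps d M Y x =
  norm2 Y * linearization (psi eps d M) ((Y, S, w) : vars R I) x.
Proof.
move=> Y0; have dpsi := is_diff_psi S w Y0.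
rewrite /linearization (diff_val (is_diff_def := dpsi)).
case: x => [[Y' S'] w'].
rewrite /cut_lhs /psi /= dotpBr -norm2_sqr (dotpC (_ - _)) dotpBr (dotpC d) (dotpC d).
have : norm2 Y != 0 by rewrite norm2_eq0.
move: (norm2 Y) => N N0.
by field.
Qed.

(** Validity without differentiability: only Cauchy-Schwarz is used, so that
    [Yb = 0] is covered. *)
Lemma cut_lhs_le (Yb Y : 'rV[R]_I) (S w : R) : 0 <= eps ->
  cut_lhs eps d M Yb (Y, S, w) <= norm2 Yb * psi eps d M (Y, S, w).
Proof.
move=> eps0; have := ler_wpM2l eps0 (dotp_le_norm2 Yb Y).
rewrite /cut_lhs /psi /=; lra.
Qed.

End constraint.

Theorem proposition4p2 (R : realType) (I J T H : nat)
    (I_gt0 : (0 < I)%N) (J_gt0 : (0 < J)%N)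
    (T_gt0 : (0 < T)%N) (H_gt0 : (0 < H)%N)
    (eps : R) (eps_ge0 : 0 <= eps)
    (d : 'I_H -> 'rV[R]_I) (M : 'I_H -> R)
    (c : 'I_J -> 'I_I -> R) (mu : 'I_T -> R) (muinf : R)
    (alpha : R) (alpha01 : 0 <= alpha <= 1)
    (p : lambda_point R I J T H) (pL : Lambda alpha c mu muinf p)
    (j : 'I_J) (t : 'I_T) (h : 'I_H) :
  [/\ forall (Y : 'rV[R]_I) (S w : R),
        eps * norm2 Y + dotp Y (d h) - S <= M h * (1 - w) ->
        eps * dotp (ptY p j t) Y
          + (dotp Y (d h) - S - M h + M h * w) * norm2 (ptY p j t) <= 0,
      ptY p j t != 0 -> forall Sb wb : R,
        is_OA_cut (psi eps (d h) (M h)) (ptY p j t, Sb, wb)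
          (cut_lhs eps (d h) (M h) (ptY p j t)) /\
        forall (Y : 'rV[R]_I) (S w : R),
          eps * dotp (ptY p j t) Y
            + (dotp Y (d h) - S - M h + M h * w) * norm2 (ptY p j t) <= 0 <->
          linearization (psi eps (d h) (M h)) (ptY p j t, Sb, wb) (Y, S, w)
            <= 0 &
      ptY p j t = 0 -> forall (Y : 'rV[R]_I) (S w : R),
        eps * dotp (ptY p j t) Y
          + (dotp Y (d h) - S - M h + M h * w) * norm2 (ptY p j t) <= 0].
Proof.
split=> [Y S w feas|Y0 Sb wb|-> Y S w].
- apply: (le_trans (cut_lhs_le (M h) (d h) (ptY p j t) Y S w eps_ge0)).
  by rewrite mulr_ge0_le0 ?norm2_ge0// /psi /= subr_le0.
- have norm_gt0 : 0 < norm2 (ptY p j t) by rewrite norm2_gt0.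
  split=> [|Y S w].
    split; first exact: convex_psi.
      exact: (ex_diff (is_diff_def := is_diff_psi eps (M h) (d h) Sb wb Y0)).
    exists (norm2 (ptY p j t)) => // x; exact: linearization_psi.
  have := linearization_psi eps (M h) (d h) Sb wb (Y, S, w) Y0.
  by rewrite /cut_lhs /= => ->; rewrite pmulr_rle0.
- by rewrite dot0p norm20 !mulr0 addr0.
Qed.
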